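(* Let $n>1$ and let DLF be any deadlock-free mutual exclusion protocol for $n$ processes. Consider Algorithm B (given in the context) run by $p_0,\dots,p_{n-1}$ on top of DLF, with atomic registers FLAG$[0],\dots,$FLAG$[n-1]$ and TURN. When a process completes W1, then it enters the critical section after losing at most $n(n-1)-1$ competitions (counted from the moment at which it completes W1).
   Context: Setting. $n$ processes $p_0,\dots,p_{n-1}$ run in parallel, each sequentially executing its code. Processes are reliable (each correctly executes its code and keeps making progress) and asynchronous (arbitrary finite speed). They interact through shared registers by reads and writes, which take time, are non-blocking, may overlap, and always terminate. Each process may repeatedly invoke $\mathtt{lock}$; when its $\mathtt{lock}$ terminates it enters its critical section, which it leaves after finite time, then running $\mathtt{unlock}$. A mutual exclusion protocol guarantees that at most one process at a time is in its critical section. It is deadlock-free if, whenever at some time at least one process is running its $\mathtt{lock}$, then afterwards some process will enter its critical section. Atomic registers: a register behaves as if each read and write takes effect at a single point in time (its execution point) between its start and termination; different actions have different execution points; the value changes only at execution points of writes, and a read returns the value at its execution point. Algorithm B. DLF, with functions DLF.lock and DLF.unlock, is used as a black box operating on its own registers; the code executed by a process between the end of DLF.lock and the start of DLF.unlock plays the role of DLF's critical section. Shared registers: FLAG$[i]\in\{0,1\}$ for each $i$, and TURN $\in\{0,\dots,n-1\}$; $tmp$ is local. Line 1: initialize FLAG$[i]$ to 0 for all $i$, and TURN to any process ID. Line 3: $\mathtt{lock}(i)$ := Line 4: FLAG$[i]\leftarrow 1$ (write W1) Line 5: repeat Line 6: $tmp\leftarrow$ TURN (read R1) Line 7: until ($tmp=i$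 or FLAG$[tmp]=0$) (read R2) Line 8: DLF.lock$(i)$ Line 10: $\mathtt{unlock}(i)$ := Line 11: FLAG$[i]\leftarrow 0$ (write W2) Line 12: $tmp\leftarrow$ TURN (read R3) Line 13: if FLAG$[tmp]=0$ (read R4) then Line 14: TURN $\leftarrow (tmp+1)\bmod n$ (write W3) Line 15: DLF.unlock$(i)$ A process $p_i$ running $\mathtt{lock}$ loses a competition with $p_j$, $j\ne i$, each time a $\mathtt{lock}$ of $p_j$ overlapping in time with that $\mathtt{lock}$ of $p_i$ terminates earlier than it; the loss occurs at the moment $p_j$'s $\mathtt{lock}$ terminates. *)

(* Defs.v *)
From HB Require Import structures.
From mathcomp Require Import all_boot.
Set Implicit Arguments.
Unset Strict Implicit.
Unset Printing Implicit Defensive.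

(* What a process is doing: [Locking] while it runs its lock, [Unlocking] while
   it runs its unlock, [Remainder] when it is not involved in the protocol. *)
Inductive region := Remainder | Locking | Critical | Unlocking.

Definition region_eq_dec : comparable region.
Proof. by move=> x y; rewrite /decidable; decide equality. Defined.

HB.instance Definition _ := hasDecEq.Build region (compareP region_eq_dec).

(* The legal effects of one step of a process on its region: starting or
   terminating lock or unlock, or working inside one of the two. *)
Definition region_step (x y : region) : bool :=
  match x, y with
  | Remainder, Locking | Locking, Locking | Locking, Critical
  | Critical, Unlocking | Unlocking, Unlocking | Unlocking, Remainder => true
  | _, _ => false
  end.

(* The code of a lock/unlock pair for n processes.  A step of process [i]
   involves its own local state (which persists between invocations) and the
   shared registers only.  [shared] may record accesses in progress and [step]
   is a relation, so registers of any kind (atomic or not) can be represented.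
   [step_total] says that no access ever blocks a process. *)
Record protocol (n : nat) := Protocol {
  shared : Type;
  local : Type;
  init_shared : shared -> Prop;
  init_local : 'I_n -> local -> Prop;
  region_of : local -> region;
  step : 'I_n -> local -> shared -> local -> shared -> Prop;
  init_region : forall i l, init_local i l -> region_of l = Remainder;
  step_region : forall i l s l' s',
    step i l s l' s' -> region_step (region_of l) (region_of l');
  step_total : forall i l s, exists l' s', step i l s l' s'
}.

(* An execution, as the sequence of its events: the state at time [t] is
   [(loc t, sh t)], and [sched t] tells which process takes a step between
   times [t] and [t.+1] ([None]: nothing happens).  Asynchrony: the schedule is
   arbitrary up to [exec_progress], which says that a process running lock or
   unlock keeps making progress and that every critical section is left after
   finite time.  A process may stay in its remainder for ever. *)
Record execution (n : nat) (P : protocol n) := Execution {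
  loc : nat -> 'I_n -> local P;
  sh : nat -> shared P;
  sched : nat -> option 'I_n;
  exec_init_shared : init_shared (sh 0);
  exec_init_local : forall i, init_local i (loc 0 i);
  exec_step : forall t i, sched t = Some i ->
    step i (loc t i) (sh t) (loc t.+1 i) (sh t.+1);
  exec_frame : forall t i, sched t <> Some i -> loc t.+1 i = loc t i;
  exec_idle : forall t, sched t = None -> sh t.+1 = sh t;
  exec_progress : forall t i, region_of (loc t i) <> Remainder ->
    exists2 t', t <= t' & sched t' = Some i
}.

Section Properties.
Variables (n : nat) (P : protocol n).
Implicit Types (r : execution P) (i j : 'I_n) (t : nat).

Definition region_at r t i : region := region_of (loc r t i).

(* The step between times [t] and [t.+1] terminates a lock of [i]. *)
Definition enters_critical r t i : bool :=
  (region_at r t i == Locking) && (region_at r t.+1 i == Critical).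

Definition mutual_exclusion : Prop :=
  forall r t i j,
    region_at r t i = Critical -> region_at r t j = Critical -> i = j.

Definition deadlock_free : Prop :=
  forall r t, (exists i, region_at r t i = Locking) ->
    exists2 t', t <= t' & exists j, enters_critical r t' j.

(* The step at [a] starts a lock of [i] which the step at [b] terminates. *)
Definition is_lock r i (a b : nat) : bool :=
  [&& a < b, region_at r a i == Remainder,
      [forall t : 'I_b.+1, (a < t) ==> (region_at r t i == Locking)]
    & region_at r b.+1 i == Critical].

(* The number of competitions which process [i], during its lock [a, b], loses
   after time [t]: all pairs of a process [j != i] and a lock [c, d] of [j]
   overlapping with [a, b] and terminating earlier than it, the loss
   occurring at [d]. *)
Definition losses r i (a b t : nat) : nat :=
  \sum_(j < n | j != i)
    #|[set cd : 'I_b * 'I_b |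
        [&& is_lock r j cd.1 cd.2, a < cd.2, cd.1 < b & t < cd.2]]|.

End Properties.

Section AlgorithmB.
Variables (n : nat) (DLF : protocol n).

(* The code of process [i], with atomic registers FLAG[0..n-1] and TURN:
     lock(i)   := FLAG[i] <- 1 (W1);
                  repeat tmp <- TURN (R1) until tmp = i or FLAG[tmp] = 0 (R2);
                  DLF.lock(i)
     unlock(i) := FLAG[i] <- 0 (W2);
                  tmp <- TURN (R3);
                  if FLAG[tmp] = 0 (R4) then TURN <- (tmp + 1) mod n (W3);
                  DLF.unlock(i)
   Each access takes three steps: its start, its execution point and its
   termination.  R2 is skipped when tmp = i. *)
Inductive access := W1 | R1 | R2 | W2 | R3 | R4 | W3.
Inductive stage := Ready | Started | Executed.

(* [DLFlock] and [DLFunlock]: the process is at the last line of lock, resp.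
   of unlock. *)
Inductive control :=
  | Idle | InCritical | Access of access & stage | DLFlock | DLFunlock.

Record bshared := BShared {
  FLAG : {ffun 'I_n -> bool};
  TURN : 'I_n;
  dlf_shared : shared DLF
}.

(* [flag] holds the value returned by the last read R2 or R4. *)
Record blocal := BLocal {
  ctl : control;
  tmp : 'I_n;
  flag : bool;
  dlf_local : local DLF
}.

Definition goto (c : control) (l : blocal) : blocal :=
  BLocal c (tmp l) (flag l) (dlf_local l).

Definition write_flag (i : 'I_n) (b : bool) (s : bshared) : bshared :=
  BShared [ffun j => if j == i then b else FLAG s j] (TURN s) (dlf_shared s).

(* What happens at the execution point of an access.  [ordS] is the successor
   modulo [n]. *)
Definition execute (i : 'I_n) (a : access) (l : blocal) (s : bshared) :
    blocal * bshared :=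
  match a with
  | W1 => (l, write_flag i true s)
  | W2 => (l, write_flag i false s)
  | R1 | R3 => (BLocal (ctl l) (TURN s) (flag l) (dlf_local l), s)
  | R2 | R4 => (BLocal (ctl l) (tmp l) (FLAG s (tmp l)) (dlf_local l), s)
  | W3 => (l, BShared (FLAG s) (ordS (tmp l)) (dlf_shared s))
  end.

(* Where control goes when an access terminates. *)
Definition next (i : 'I_n) (a : access) (l : blocal) : control :=
  match a with
  | W1 => Access R1 Ready
  | R1 => if tmp l == i then DLFlock else Access R2 Ready
  | R2 => if flag l then Access R1 Ready else DLFlock
  | W2 => Access R3 Ready
  | R3 => Access R4 Ready
  | R4 => if flag l then DLFunlock else Access W3 Ready
  | W3 => DLFunlock
  end.

Definition dlf_step (i : 'I_n) (l : blocal) (s : bshared)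
    (l' : blocal) (s' : bshared) : Prop :=
  exists d m, [/\ step i (dlf_local l) (dlf_shared s) d m,
    l' = BLocal (ctl l) (tmp l) (flag l) d & s' = BShared (FLAG s) (TURN s) m].

(* At [DLFlock] the steps of DLF.lock are run from its start until DLF is in
   its critical section, and then the lock of Algorithm B returns; similarly
   at [DLFunlock].  Between the two DLF takes no step. *)
Definition bstep (i : 'I_n) (l : blocal) (s : bshared)
    (l' : blocal) (s' : bshared) : Prop :=
  match ctl l with
  | Idle => l' = goto (Access W1 Ready) l /\ s' = s
  | InCritical => l' = goto (Access W2 Ready) l /\ s' = s
  | Access a Ready => l' = goto (Access a Started) l /\ s' = s
  | Access a Started =>
      (l', s') = execute i a (goto (Access a Executed) l) s
  | Access a Executed => l' = goto (next i a l) l /\ s' = s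
  | DLFlock =>
      if region_of (dlf_local l) == Critical
      then l' = goto InCritical l /\ s' = s else dlf_step i l s l' s'
  | DLFunlock =>
      if region_of (dlf_local l) == Remainder
      then l' = goto Idle l /\ s' = s else dlf_step i l s l' s'
  end.

Definition bregion (l : blocal) : region :=
  match ctl l with
  | Idle => Remainder
  | InCritical => Critical
  | Access (W1 | R1 | R2) _ | DLFlock => Locking
  | Access (W2 | R3 | R4 | W3) _ | DLFunlock => Unlocking
  end.

Definition binit_shared (s : bshared) : Prop :=
  (forall i, FLAG s i = false) /\ init_shared (dlf_shared s).

Definition binit_local (i : 'I_n) (l : blocal) : Prop :=
  ctl l = Idle /\ init_local i (dlf_local l).

Fact binit_region i l : binit_local i l -> bregion l = Remainder.
Proof. by rewrite /bregion => -[->]. Qed.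

Fact bstep_region i l s l' s' :
  bstep i l s l' s' -> region_step (bregion l) (bregion l').
Proof.
rewrite /bstep /bregion; case: l => c t f d /=.
case: c => [||[] []||] /=; try by case=> -> _.
all: try by case=> -> _ /=; case: ifP.
all: try by case: ifP => _; [case=> -> _ | case=> d' [m [_ -> _]]].
Qed.

Fact bstep_total i l s : exists l' s', bstep i l s l' s'.
Proof.
have dlf_total : exists l' s', dlf_step i l s l' s'.
  have [d [m dm]] := step_total i (dlf_local l) (dlf_shared s).
  by do 2!eexists; exists d, m.
rewrite /bstep; case: (ctl l) => [||a st||]; try by do 2!eexists.
- case: st; try by do 2!eexists.
  by case: (execute i a _ s) => l' s'; exists l', s'.
- by case: (_ == _) => //; do 2!eexists.
- by case: (_ == _) => //; do 2!eexists.
Qed.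

Definition algorithmB : protocol n :=
  Protocol binit_shared binit_region bstep_region bstep_total.

(* Between times [t] and [t.+1] process [i] terminates the access [a]. *)
Definition completes (r : execution algorithmB) (t : nat) (i : 'I_n)
    (a : access) : Prop :=
  sched r t = Some i /\ ctl (loc r t i : blocal) = Access a Executed.

End AlgorithmB.

(* Main.v *)
(* Only the owner of DLF's critical section writes TURN, and it increments
   TURN exactly when it finds FLAG[TURN] lowered. While TURN = k, once an
   owner finds FLAG[k] raised it remains raised until p_k itself leaves and
   increments TURN, so every process which has already been served in this
   phase is held at its gate: each process enters at most once per phase. When
   p_i completes W1, TURN needs at most n phases to reach i and to serve p_i,
   each with at most n - 1 losses; in the phase TURN = i the process that set
   TURN to i cannot enter, which saves one loss. This count is a function of
   the state alone, [potential], which never increases and which drops at each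
   loss. The lock of p_i terminates because otherwise, once the entries stop,
   TURN is constant, nobody is left in DLF.lock, and the gate lets through
   p_TURN if it waits, or p_i if it does not. *)
Require Import Defs.
From mathcomp Require Import all_boot zify.
From Stdlib Require Import Classical.

(** * Executions of an arbitrary protocol *)

Section Executions.
Set Implicit Arguments.
Unset Strict Implicit.
Unset Printing Implicit Defensive.

Variables (n : nat) (P : protocol n) (r : execution P).
Implicit Types (i j : 'I_n) (a b c d t u : nat).

Lemma next_scheduled i t : region_at r t i <> Remainder ->
  exists u, [/\ t <= u, sched r u = Some i & loc r u i = loc r t i].
Proof.
move=> /exec_progress[u0 tu0 su0].
have ex : exists u, (t <= u) && (sched r u == Some i).
  by exists u0; rewrite tu0 su0 /=.
case: (ex_minnP ex) => u /andP[tu /eqP su] min_u; exists u; split=> //.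
rewrite -(subnK tu); have: u - t + t <= u by rewrite subnK.
elim: (u - t) => [//|k IH]; rewrite addSn => ku.
rewrite exec_frame ?IH// 1?ltnW// => sk.
by have := min_u (k + t); rewrite sk eqxx leq_addl => /(_ isT);
  rewrite leqNgt ku.
Qed.

Lemma region_at_step i t : region_at r t i <> region_at r t.+1 i ->
  sched r t = Some i /\ region_step (region_at r t i) (region_at r t.+1 i).
Proof.
move=> neq; have [st|/eqP st] := eqVneq (sched r t) (Some i).
  by split=> //; apply: step_region (exec_step st).
by case: neq; rewrite /region_at exec_frame.
Qed.

(** Only [Remainder] and [Locking] can precede [Locking], and every process begins in [Remainder],
    so going back from [t] reaches the start of the lock. *)
Lemma lock_start i t : region_at r t i = Locking ->
  exists a, [/\ a < t, region_at r a i = Remainder &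
    forall u, a < u <= t -> region_at r u i = Locking].
Proof.
elim: t => [|t IH] Lt.
  by have := init_region (exec_init_local r i); rewrite -/(region_at r 0 i) Lt.
case Rt : (region_at r t i).
- exists t; split=> // u tu; suff -> : u = t.+1 by [].
  by lia.
- have [a [ltat Ra La]] := IH Rt; exists a; split=> // [|u]; first exact: ltnW.
  rewrite [u <= _]leq_eqVlt => /andP[au /predU1P[->//|ut]].
  by apply: La; rewrite au.
- by have [] := @region_at_step i t; rewrite Rt Lt.
- by have [] := @region_at_step i t; rewrite Rt Lt.
Qed.

Lemma is_lockP i a b :
  reflect [/\ a < b, region_at r a i = Remainder,
      forall t, a < t <= b -> region_at r t i = Locking &
      region_at r b.+1 i = Critical]
    (is_lock r i a b).
Proof.
apply: (iffP and4P) => [[ab /eqP Ra /forallP Lab /eqP Cb]|[ab Ra Lab Cb]].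
  split=> // t /andP[lta ltb]; apply/eqP.
  by have := Lab (Ordinal (ltb : t < b.+1)); rewrite /= lta.
split; rewrite ?ab ?Ra ?Cb//; apply/forallP => t; apply/implyP => lta.
by rewrite Lab// lta -ltnS ltn_ord.
Qed.

Lemma is_lock_enters i a b : is_lock r i a b -> enters_critical r b i.
Proof.
move=> /is_lockP[ab _ Lab Cb].
by rewrite /enters_critical Lab ?Cb ?leqnn ?ab.
Qed.

Lemma is_lock_start_inj i a a' b :
  is_lock r i a b -> is_lock r i a' b -> a = a'.
Proof.
move=> /is_lockP[ab Ra Lab _] /is_lockP[ab' Ra' Lab' _].
by case: (ltngtP a a') => // lt;
  [have := Lab a' | have := Lab' a]; rewrite ?Ra ?Ra' lt ltnW// => /(_ isT).
Qed.

(** Turns a count of locks into a count of entries per step, which a potential can bound. *)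
Lemma losses_le_enters i a b t :
  losses r i a b t <=
    \sum_(t.+1 <= d < b) \sum_(j < n | j != i) enters_critical r d j.
Proof.
rewrite exchange_big /=; apply: leq_sum => j ji.
rewrite [leqRHS](_ : _ = #|[set d : 'I_b | (t < d) && enters_critical r d j]|).
  (* A lock is determined by the step that terminates it, so keeping only the end points is
     injective. *)
  rewrite -(card_in_imset (f := snd)) => [|[c d] [c' d']].
    apply/subset_leq_card/subsetP => _ /imsetP[[c d] + ->].
    by rewrite !inE /= => /and4P[/is_lock_enters-> _ _ ->].
  rewrite !inE /= => /and4P[L _ _ _] /and4P[L' _ _ _] dd; congr pair => //.
  by apply/val_inj/(is_lock_start_inj L); rewrite dd.
rewrite cardsE -sum1_card (big_nat_widenl _ 0)//= big_mkord big_mkcond /=.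
rewrite [RHS]big_mkcond /=; apply: eq_bigr => d _.
by rewrite unfold_in /=; case: ltnP; case: enters_critical.
Qed.

End Executions.

(** * The execution of DLF inside an execution of Algorithm B *)

Section AlgorithmB.
Set Implicit Arguments.
Unset Strict Implicit.
Unset Printing Implicit Defensive.

Variables (n : nat) (DLF : protocol n).
Hypotheses (DLF_mutex : mutual_exclusion DLF) (DLF_dlf : deadlock_free DLF).
Variable r : execution (algorithmB DLF).
Implicit Types (i j k m : 'I_n) (t u : nat) (l : blocal DLF) (s : bshared DLF).

Definition lo t i : blocal DLF := loc r t i.
Definition st t : bshared DLF := sh r t.
Definition dlf_region l : region := region_of (dlf_local l).

Lemma lo_step t i : sched r t = Some i ->
  bstep i (lo t i) (st t) (lo t.+1 i) (st t.+1).
Proof. exact: exec_step. Qed.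

Lemma lo_frame t i : sched r t <> Some i -> lo t.+1 i = lo t i.
Proof. exact: exec_frame. Qed.

Lemma st_idle t : sched r t = None -> st t.+1 = st t.
Proof. exact: exec_idle. Qed.

Definition runs_dlf l : bool :=
  match ctl l with
  | DLFlock => dlf_region l != Critical
  | DLFunlock => dlf_region l != Remainder
  | _ => false
  end.

Lemma bstep_dlf i l s l' s' : bstep i l s l' s' ->
  if runs_dlf l then dlf_step i l s l' s'
  else dlf_local l' = dlf_local l /\ dlf_shared s' = dlf_shared s.
Proof.
rewrite /bstep /runs_dlf /dlf_region.
case: (ctl l) => [||a []||]; try by case=> -> ->.
- by case: a => -[-> ->].
- by case: eqP => //= _ [-> ->].
- by case: eqP => //= _ [-> ->].
Qed.

(** At [DLFlock] DLF may not have started yet, or may be critical already before the lock of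
    Algorithm B returns; similarly at [DLFunlock]. Elsewhere control fixes the region of DLF. *)
Definition dlf_consistent l : bool :=
  match ctl l with
  | Idle | Access (W1 | R1 | R2) _ => dlf_region l == Remainder
  | InCritical | Access (W2 | R3 | R4 | W3) _ => dlf_region l == Critical
  | DLFlock => dlf_region l != Unlocking
  | DLFunlock => dlf_region l != Locking
  end.

Lemma bstep_consistent i l s l' s' :
  bstep i l s l' s' -> dlf_consistent l -> dlf_consistent l'.
Proof.
rewrite /bstep /dlf_consistent /dlf_region.
case ctl_l: (ctl l) => [||a []||] /=; try by case=> -> _.
- by case: a {ctl_l} => -[-> _].
- by case: a {ctl_l} => /= -[-> _] /= /eqP->; do ?case: ifP.
- case: eqP => [C [-> _] _ /=|C [d [x [/step_region + -> _]]]]; first exact/eqP.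
  by rewrite /= ctl_l; case: (region_of (dlf_local l)) C => // _;
    case: region_of.
- case: eqP => [C [-> _] _ /=|C [d [x [/step_region + -> _]]]]; first exact/eqP.
  by rewrite /= ctl_l; case: (region_of (dlf_local l)) C => // _;
    case: region_of.
Qed.

Lemma lo_consistent t i : dlf_consistent (lo t i).
Proof.
elim: t => [|t IH].
  have [] : binit_local i (lo 0 i) := exec_init_local r i.
  by rewrite /dlf_consistent /dlf_region => -> /init_region->.
have [/lo_step/bstep_consistent|/eqP/lo_frame->//] :=
  eqVneq (sched r t) (Some i).
exact.
Qed.

Definition steps_to_unlock (c : control) : nat :=
  match c with
  | DLFlock => 14 | InCritical => 13
  | Access W2 Ready => 12 | Access W2 Started => 11 | Access W2 Executed => 10
  | Access R3 Ready => 9 | Access R3 Started => 8 | Access R3 Executed => 7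
  | Access R4 Ready => 6 | Access R4 Started => 5 | Access R4 Executed => 4
  | Access W3 Ready => 3 | Access W3 Started => 2 | Access W3 Executed => 1
  | _ => 0
  end.

Lemma bstep_to_unlock i l s l' s' :
  bstep i l s l' s' -> dlf_consistent l -> dlf_region l = Critical ->
  ~~ runs_dlf l ->
  steps_to_unlock (ctl l') < steps_to_unlock (ctl l).
Proof.
rewrite /bstep /dlf_consistent /runs_dlf => + + C; rewrite -/(dlf_region l) C.
case: (ctl l) => [||[] []||] //=; try by case=> -> _.
by case=> -> _ /=; case: ifP.
Qed.

(** The progress requirement for the extracted execution of DLF. While DLF is locking or unlocking,
    the next step of [i] is one of DLF; while it is critical, [steps_to_unlock] decreases until
    [DLFunlock] is reached. *)
Lemma next_dlf_step t i : dlf_region (lo t i) <> Remainder ->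
  exists u, [/\ t <= u, sched r u = Some i, runs_dlf (lo u i) &
    dlf_local (lo u i) = dlf_local (lo t i)].
Proof.
have [N] := ubnP (steps_to_unlock (ctl (lo t i))).
elim: N t => // N IH t; rewrite ltnS => leN NR.
have ok := lo_consistent t i.
have [|u [tu su lou]] := @next_scheduled _ _ r i t.
  move: ok NR; rewrite /dlf_consistent /region_at /= /bregion /lo.
  by case: ctl => [||[]||] //= /eqP->.
case: (boolP (runs_dlf (lo t i))) => [run|Nrun].
  by exists u; split=> //; rewrite /lo lou.
have C : dlf_region (lo t i) = Critical.
  move: ok NR Nrun; rewrite /dlf_consistent /runs_dlf.
  by case: ctl => [||[]||] //; case: dlf_region.
have step := lo_step su; move: (step); rewrite /lo lou -/(lo t i) => step'.
have := bstep_dlf step'; rewrite (negbTE Nrun) => -[locu _].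
have [||v [uv sv rv lov]] := IH u.+1.
- by apply: leq_trans (bstep_to_unlock step' ok C Nrun) leN.
- by rewrite /dlf_region /lo locu -/(dlf_region _) C.
exists v; split=> //; first exact: leq_trans (leqW tu) uv.
by rewrite lov -locu.
Qed.

(** The time scale is kept: a step outside DLF becomes an idle step of DLF. *)
Definition dlf_sched t : option 'I_n :=
  if sched r t is Some i then if runs_dlf (lo t i) then Some i else None
  else None.

Lemma dlf_schedP t i :
  dlf_sched t = Some i <-> sched r t = Some i /\ runs_dlf (lo t i).
Proof.
rewrite /dlf_sched; split; last by case=> -> ->.
by case: (sched r t) => // j; case: ifP => // run [<-].
Qed.

Fact dlf_init_shared : init_shared (dlf_shared (st 0)).
Proof. by have [] : binit_shared (st 0) := exec_init_shared r. Qed.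

Fact dlf_init_local i : init_local i (dlf_local (lo 0 i)).
Proof. by have [] : binit_local i (lo 0 i) := exec_init_local r i. Qed.

Fact dlf_exec_step t i : dlf_sched t = Some i ->
  step i (dlf_local (lo t i)) (dlf_shared (st t))
    (dlf_local (lo t.+1 i)) (dlf_shared (st t.+1)).
Proof.
move=> /dlf_schedP[/lo_step/bstep_dlf + run].
by rewrite run => -[d [x [? -> ->]]].
Qed.

Fact dlf_exec_frame t i : dlf_sched t <> Some i ->
  dlf_local (lo t.+1 i) = dlf_local (lo t i).
Proof.
have [si|/eqP/lo_frame->//] := eqVneq (sched r t) (Some i).
rewrite /dlf_sched si; have := bstep_dlf (lo_step si).
by case: ifP => // _ [-> _].
Qed.

Fact dlf_exec_idle t : dlf_sched t = None ->
  dlf_shared (st t.+1) = dlf_shared (st t).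
Proof.
case si : (sched r t) => [i|]; last by rewrite st_idle.
rewrite /dlf_sched si; have := bstep_dlf (lo_step si).
by case: ifP => // _ [_ ->].
Qed.

Fact dlf_exec_progress t i : region_of (dlf_local (lo t i)) <> Remainder ->
  exists2 u, t <= u & dlf_sched u = Some i.
Proof.
by move=> /next_dlf_step[u [tu su ru _]]; exists u => //; apply/dlf_schedP.
Qed.

Definition dlf_execution : execution DLF :=
  Execution dlf_init_shared dlf_init_local dlf_exec_step dlf_exec_frame
    dlf_exec_idle dlf_exec_progress.

Lemma dlf_critical_inj t i j :
  dlf_region (lo t i) = Critical -> dlf_region (lo t j) = Critical -> i = j.
Proof. exact: (DLF_mutex (r := dlf_execution)). Qed.

Lemma dlf_locking_enters t i : dlf_region (lo t i) = Locking ->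
  exists u j, [/\ t <= u, dlf_region (lo u j) = Locking &
    dlf_region (lo u.+1 j) = Critical].
Proof.
move=> L; have [u tu [j /andP[/eqP Lj /eqP Cj]]] :
    exists2 u, t <= u & exists j, enters_critical dlf_execution u j.
  by apply: DLF_dlf; exists i.
by exists u, j.
Qed.

Lemma next_step t i : bregion (lo t i) <> Remainder ->
  exists u, [/\ t <= u, lo u i = lo t i &
    bstep i (lo t i) (st u) (lo u.+1 i) (st u.+1)].
Proof.
move=> /(next_scheduled (r := r))[u [tu su lou]]; exists u; split=> //.
by rewrite -[lo t i]lou; apply: lo_step.
Qed.

(** * The values of FLAG and the ownership of the critical section *)

Definition raised (c : control) : bool :=
  match c with
  | Access W1 Executed | Access (R1 | R2) _ | DLFlock | InCritical
  | Access W2 (Ready | Started) => true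
  | _ => false
  end.

Definition in_critical (c : control) : bool :=
  match c with
  | InCritical | Access (W2 | R3 | R4 | W3) _ => true
  | _ => false
  end.

Definition at_gate (c : control) : bool :=
  if c is Access (W1 | R1 | R2) _ then true else false.

Lemma bstep_FLAG i l s l' s' :
  bstep i l s l' s' -> FLAG s i = raised (ctl l) ->
  FLAG s' = [ffun j => if j == i then raised (ctl l') else FLAG s j].
Proof.
have keep b :
    FLAG s i = b -> FLAG s = [ffun j => if j == i then b else FLAG s j].
  by move=> <-; apply/ffunP => j; rewrite ffunE; case: eqP => // ->.
rewrite /bstep; case ctl_l: (ctl l) => [||[] []||] /=; try by case=> -> ->.
all: try by case=> -> -> /keep /=; do ?case: ifP.
all: case: ifP => _; first by case=> -> -> /keep.
all: by case=> d [x [_ -> ->]] /keep; rewrite /= ctl_l.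
Qed.

Lemma FLAG_raised t i : FLAG (st t) i = raised (ctl (lo t i)).
Proof.
elim: t i => [|t IH] i.
  have [-> _] : binit_shared (st 0) := exec_init_shared r.
  by have [-> _] : binit_local i (lo 0 i) := exec_init_local r i.
case sm : (sched r t) => [m|]; last by rewrite st_idle// lo_frame ?sm.
rewrite (bstep_FLAG (lo_step sm))// ffunE; case: eqP => [->//|im].
by rewrite IH lo_frame// sm => -[/esym].
Qed.

Lemma bstep_TURN i l s l' s' : bstep i l s l' s' ->
  TURN s' = if ctl l is Access W3 Started then ordS (tmp l) else TURN s.
Proof.
rewrite /bstep; case: (ctl l) => [||[] []||] /=; try by case=> _ ->.
all: by case: ifP => _; [case=> _ -> | case=> d [x [_ _ ->]]].
Qed.

Lemma in_critical_dlf t i :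
  in_critical (ctl (lo t i)) -> dlf_region (lo t i) = Critical.
Proof.
have := lo_consistent t i; rewrite /dlf_consistent.
by case: ctl => [||[]||] //= => [|_|_|_|_] /eqP.
Qed.

Lemma in_critical_inj t i j :
  in_critical (ctl (lo t i)) -> in_critical (ctl (lo t j)) -> i = j.
Proof.
by move=> /in_critical_dlf Ci /in_critical_dlf; apply: dlf_critical_inj.
Qed.

Lemma bstep_in_critical i l s l' s' : bstep i l s l' s' ->
  in_critical (ctl l') -> in_critical (ctl l) \/ ctl l = DLFlock.
Proof.
rewrite /bstep; case ctl_l: (ctl l) => [||[] []||] /=;
  try by case=> -> _ //=; auto.
- by case=> -> _ /=; case: ifP.
- by case=> -> _ /=; case: ifP.
- by right.
- by case: ifP => _; [case=> -> | case=> d [x [_ -> _]]; rewrite /= ctl_l].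
Qed.

(** * Progress: while somebody is locking, somebody will enter *)

Lemma dlf_critical_enters t i :
  ctl (lo t i) = DLFlock -> dlf_region (lo t i) = Critical ->
  exists2 u, t <= u & exists j, enters_critical r u j.
Proof.
move=> ctl_i C.
have [|u [tu lou]] := @next_step t i; first by rewrite /bregion ctl_i.
rewrite /bstep ctl_i -/(dlf_region _) C eqxx => -[lou' _].
exists u => //; exists i.
rewrite /enters_critical /region_at /= -/(lo u i) -/(lo u.+1 i) lou lou'.
by rewrite /bregion /= ctl_i.
Qed.

(** If DLF.lock is running, deadlock-freedom of DLF makes some [j] critical in DLF; this [j] is at
    [DLFlock] and can only return. If DLF.lock has not started, the next step of [i] starts it. *)
Lemma DLFlock_enters t i : ctl (lo t i) = DLFlock ->
  exists2 u, t <= u & exists j, enters_critical r u j.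
Proof.
have locking v j : dlf_region (lo v j) = Locking ->
    exists2 u, v <= u & exists j, enters_critical r u j.
  move=> /dlf_locking_enters[u [{}j [vu Lj Cj]]].
  have ctl_j : ctl (lo u j) = DLFlock.
    have := lo_consistent u j; rewrite /dlf_consistent Lj.
    by case: ctl => [||[]||].
  have sj : sched r u = Some j.
    by apply/eqP/negP => /negP/eqP/lo_frame E; rewrite E Lj in Cj.
  have ctl_j' : ctl (lo u.+1 j) = DLFlock.
    have := lo_step sj; rewrite /bstep ctl_j -/(dlf_region _) Lj /=.
    by case=> d [x [_ -> _]].
  have [w uw ent] := dlf_critical_enters ctl_j' Cj.
  by exists w => //; apply: leq_trans vu (ltnW uw).
move=> ctl_i; case Ri: (dlf_region (lo t i)); first last.
- by have := lo_consistent t i; rewrite /dlf_consistent ctl_i Ri.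
- exact: dlf_critical_enters ctl_i Ri.
- exact: locking Ri.
have [|u [tu lou]] := @next_step t i; first by rewrite /bregion ctl_i.
rewrite /bstep ctl_i -/(dlf_region _) Ri /= => -[d [x [/step_region]]].
rewrite -/(dlf_region _) Ri => + lou' _; case Rd: (region_of d) => // _.
have [|w uw ent] := locking u.+1 i; first by rewrite /dlf_region lou'.
by exists w => //; apply: leq_trans tu (ltnW uw).
Qed.

Section Quiet.
Variable T : nat.
Hypothesis no_DLFlock : forall u j, T <= u -> ctl (lo u j) <> DLFlock.

Lemma quiet_not_in_critical : exists2 T', T <= T' &
  forall u j, T' <= u -> ~~ in_critical (ctl (lo u j)).
Proof.
have stable T' : T <= T' -> (forall j, ~~ in_critical (ctl (lo T' j))) ->
    forall u j, T' <= u -> ~~ in_critical (ctl (lo u j)).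
  move=> TT' NC u j /subnK <-; elim: (u - T') => [//|v IH]; rewrite addSn.
  have [/lo_step/bstep_in_critical crit|/eqP/lo_frame->//] :=
    eqVneq (sched r (v + T')) (Some j).
  apply/negP => /crit[]; first exact/negP.
  by apply: no_DLFlock; lia.
have [/existsP[m Cm]|/existsPn NC] :=
  boolP [exists m, in_critical (ctl (lo T m))]; last first.
  by exists T => //; apply: stable.
have [|u [Tu su run loc_u]] := @next_dlf_step T m.
  by rewrite in_critical_dlf.
have Cu : dlf_region (lo u m) = Critical.
  by rewrite /dlf_region loc_u; apply: in_critical_dlf.
(* At [u] the owner is still critical in DLF but takes a step of DLF, so it is already at
   [DLFunlock], and mutual exclusion of DLF rules out everybody else. *)
exists u => //; apply: stable => // j; apply/negP => Cj.
have jm := dlf_critical_inj (in_critical_dlf Cj) Cu.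
by move: run Cj; rewrite jm /runs_dlf Cu; case: ctl.
Qed.

Hypothesis not_in_critical :
  forall u j, T <= u -> ~~ in_critical (ctl (lo u j)).

Lemma quiet_TURN u : T <= u -> TURN (st u) = TURN (st T).
Proof.
move=> /subnK <-; elim: (u - T) => [//|v IH]; rewrite addSn -IH.
case sm: (sched r (v + T)) => [m|]; last by rewrite st_idle.
rewrite (bstep_TURN (lo_step sm)).
by have := @not_in_critical (v + T) m (leq_addl _ _); case: ctl => [||[] []||].
Qed.

(** [R1 Executed] gets the largest value instead of 0: its [tmp] may have been read before [T], so
    one more round of the loop is made. *)
Definition steps_to_R1 (c : control) : nat :=
  match c with
  | Access R1 Executed => 9
  | Access R2 Ready => 8 | Access R2 Started => 7 | Access R2 Executed => 6
  | Access W1 Ready => 5 | Access W1 Started => 4 | Access W1 Executed => 3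
  | Access R1 Ready => 2 | Access R1 Started => 1
  | _ => 0
  end.

Lemma quiet_reads_TURN t i : T <= t -> at_gate (ctl (lo t i)) ->
  exists u, [/\ T <= u, ctl (lo u i) = Access R1 Executed &
    tmp (lo u i) = TURN (st T)].
Proof.
have [N] := ubnP (steps_to_R1 (ctl (lo t i))); elim: N t => // N IH t.
rewrite ltnS => leN Tt gate_i.
have [|u [tu lou]] := @next_step t i.
  by move: gate_i; rewrite /bregion; case: ctl => [||[]||].
have Tu : T <= u.+1 by apply: leq_trans Tt (leqW tu).
have := no_DLFlock (j := i) Tu; have := IH u.+1; move: leN gate_i.
rewrite /bstep; case: (ctl (lo t i)) => [||[] []||] //= leN _ {}IH notD [].
(* Goal 5 is the execution point of R1, which yields the witness; in the others the measure drops or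
   [DLFlock] is reached. *)
5: by move=> lou' _; exists u.+1; split; rewrite ?lou' ?quiet_TURN //=;
  apply: leq_trans Tt _.
all: move=> lou' _; move: IH notD; rewrite lou' /=; do ?case: ifP => _.
all: by move=> IH notD; try by apply: IH => //; apply: leq_trans leN.
Qed.

(** With its flag raised, p_TURN would be at its gate, read its own number there and pass to
    [DLFlock]. *)
Lemma quiet_TURN_idle t : T <= t -> FLAG (st t) (TURN (st T)) = false.
Proof.
set k := TURN _ => Tt; rewrite FLAG_raised; apply/negP => raised_k.
have gate_k : at_gate (ctl (lo t k)).
  move: raised_k (@not_in_critical t k Tt) (@no_DLFlock t k Tt).
  by case: ctl => [||[]||].
have [u [Tu ctl_k tmp_k]] := quiet_reads_TURN Tt gate_k.
have [|v [uv _]] := @next_step u k; first by rewrite /bregion ctl_k.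
rewrite /bstep ctl_k /= tmp_k eqxx => -[lov _].
by apply: (@no_DLFlock v.+1 k); [lia | rewrite lov].
Qed.

Lemma quiet_not_at_gate t i : T <= t -> ~~ at_gate (ctl (lo t i)).
Proof.
move=> Tt; apply/negP => /(quiet_reads_TURN Tt)[u [Tu ctl_i tmp_i]].
have [|v [uv _]] := @next_step u i; first by rewrite /bregion ctl_i.
rewrite /bstep ctl_i /=; case: ifP => _ [lov _].
  by apply: (@no_DLFlock v.+1 i); [lia | rewrite lov].
have [|w [vw _]] := @next_step v.+1 i; first by rewrite lov.
rewrite lov /bstep /= => -[low _].
have [|x [wx _]] := @next_step w.+1 i; first by rewrite low.
rewrite low /bstep /= tmp_i quiet_TURN_idle; last by lia.
case=> lox _.
have [|y [xy _]] := @next_step x.+1 i; first by rewrite lox.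
rewrite lox /bstep /= => -[loy _].
by apply: (@no_DLFlock y.+1 i); [lia | rewrite loy].
Qed.

End Quiet.

Lemma eventually_enters t i : region_at r t i = Locking ->
  exists2 u, t <= u & exists j, enters_critical r u j.
Proof.
move=> Li; apply: NNPP => never.
have no_DLFlock u j : t <= u -> ctl (lo u j) <> DLFlock.
  move=> tu /DLFlock_enters[v uv ent]; apply: never.
  by exists v => //; apply: leq_trans tu uv.
have [T tT NC] := quiet_not_in_critical no_DLFlock.
have no_DLFlock' u j : T <= u -> ctl (lo u j) <> DLFlock.
  by move=> Tu; apply: no_DLFlock; apply: leq_trans tT Tu.
(* The only way out of the gate is [DLFlock]. *)
have gate u : t <= u -> at_gate (ctl (lo u i)).
  move=> /subnK <-; elim: (u - t) => [|v IH].
    rewrite add0n; move: Li (no_DLFlock t i (leqnn t)).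
    by rewrite /region_at /= /bregion -/(lo t i); case: ctl => [||[]||].
  rewrite addSn; have [/lo_step|/eqP/lo_frame->//] :=
    eqVneq (sched r (v + t)) (Some i).
  have := no_DLFlock (v + t).+1 i; move: IH; rewrite /bstep.
  case: (ctl (lo (v + t) i)) => [||[] []||] //= _ ND [lov _]; move: ND;
    by rewrite lov //=; case: ifP => // _ [] //; lia.
by have := quiet_not_at_gate no_DLFlock' NC i (leqnn T); rewrite gate.
Qed.

(** * What the owner knows about TURN and FLAG[TURN] *)

Definition turn_in_tmp (c : control) : bool :=
  match c with
  | Access R3 Executed | Access R4 _ | Access W3 (Ready | Started) => true
  | _ => false
  end.

Lemma TURN_frame t i : in_critical (ctl (lo t i)) -> sched r t <> Some i ->
  TURN (st t.+1) = TURN (st t).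
Proof.
move=> Ci; case sm: (sched r t) => [m|] neq; last by rewrite st_idle.
rewrite (bstep_TURN (lo_step sm)); have := @in_critical_inj t m i.
by case: (ctl (lo t m)) => [||[] []||] //= /(_ isT Ci) mi; rewrite mi in neq.
Qed.

(** TURN is written only inside the critical section, so what R3 has read stays current until the
    owner itself executes W3. *)
Lemma tmp_TURN t i : turn_in_tmp (ctl (lo t i)) -> tmp (lo t i) = TURN (st t).
Proof.
elim: t => [|t IH].
  by have [-> _] : binit_local i (lo 0 i) := exec_init_local r i.
have [si|/eqP nsi] := eqVneq (sched r t) (Some i); last first.
  rewrite lo_frame// => hi; rewrite (TURN_frame (i := i))// ?IH//.
  by move: hi; case: ctl => [||[]||].
have := lo_step si; move: IH; rewrite /bstep.
case ctl_i: (ctl (lo t i)) => [||[] []||] /= IH;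
  try by case=> -> -> /=; do ?case: ifP; auto.
all: by case: ifP => _; [case=> -> | case=> d [x [_ -> _]]; rewrite /= ctl_i].
Qed.

(** Only p_TURN can lower this flag, by its W2, and it cannot be there while another process owns
    the critical section. *)
Lemma R4_flag t i : ctl (lo t i) = Access R4 Executed -> flag (lo t i) ->
  FLAG (st t) (TURN (st t)).
Proof.
elim: t => [|t IH].
  by have [-> _] : binit_local i (lo 0 i) := exec_init_local r i.
have [si|/eqP nsi] := eqVneq (sched r t) (Some i); last first.
  rewrite lo_frame// => ctl_i fl; have {IH} := IH ctl_i fl.
  have Ci : in_critical (ctl (lo t i)) by rewrite ctl_i.
  rewrite (TURN_frame Ci nsi); set k := TURN _; rewrite !FLAG_raised.
  have [sk|/eqP/lo_frame->//] := eqVneq (sched r t) (Some k).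
  have ik : i <> k by move=> ik; rewrite sk ik in nsi.
  have := lo_step sk; have := @in_critical_inj t i k Ci; rewrite /bstep.
  case ctl_k: (ctl (lo t k)) => [||[] []||] /= inj;
    first [by move: (inj isT) | by case=> -> _ /=; do ?case: ifP
      | by case: ifP => _;
        [case=> -> | case=> d [x [_ -> _]]; rewrite /= ctl_k]].
have := lo_step si; have := @tmp_TURN t i; rewrite /bstep.
case ctl_i: (ctl (lo t i)) => [||[] []||] /= tmp_i; try by case=> -> -> //=.
all: try by case=> -> _ /=; do ?case: ifP.
- by case=> -> -> /= _; rewrite tmp_i.
all: by case: ifP => _; [case=> -> | case=> d [x [_ -> _]]; rewrite /= ctl_i].
Qed.

Lemma enters_criticalP t j : enters_critical r t j ->
  [/\ ctl (lo t j) = DLFlock, dlf_region (lo t j) = Critical &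
    ctl (lo t.+1 j) = InCritical].
Proof.
move=> /andP[/eqP Lj /eqP Cj].
have [|sj _] := @region_at_step _ _ r j t; first by rewrite Lj Cj.
have := lo_step sj; move: Lj Cj.
rewrite /region_at /= -!/(lo _ _) /bregion /bstep.
case ctl_j: (ctl (lo t j)) => [||[] []||] //= _;
  try by move=> + [E _]; rewrite E /=; try case: ifP.
by case: eqP => [C _ [E _]|_ + [d [x [_ E _]]]]; rewrite E //= ctl_j.
Qed.

(* The process has found FLAG[TURN] lowered, or is certain to find it so
   because it owns TURN itself: it is bound to increment TURN. *)
Definition will_advance t j : bool :=
  match ctl (lo t j) with
  | Access R4 Executed => ~~ flag (lo t j)
  | Access W3 (Ready | Started) => true
  | Access W2 Executed | Access R3 _ | Access R4 _ => j == TURN (st t)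
  | _ => false
  end.

Lemma will_advance_in_critical t j :
  will_advance t j -> in_critical (ctl (lo t j)).
Proof. by rewrite /will_advance; case: ctl => [||[] []||]. Qed.

Lemma will_advance_step t j : will_advance t j ->
  (will_advance t.+1 j /\ TURN (st t.+1) = TURN (st t)) \/
  (ctl (lo t.+1 j) = Access W3 Executed /\ TURN (st t.+1) = ordS (TURN (st t))).
Proof.
move=> adv; have Cj := will_advance_in_critical adv.
have [sj|/eqP nsj] := eqVneq (sched r t) (Some j); last first.
  by left; move: adv; rewrite /will_advance lo_frame// (TURN_frame Cj).
have := lo_step sj; have := @tmp_TURN t j; have := FLAG_raised t j.
move: adv; rewrite /will_advance /bstep.
case: (ctl (lo t j)) => [||[] []||] //= adv FLAG_j tmp_j;
  try by case=> -> ->; left.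
(* R4 of p_TURN itself: it reads the flag that its own W2 has lowered. *)
- case=> -> -> /=; left; split=> //.
  by rewrite tmp_j// -(eqP adv) FLAG_j.
- by case=> -> -> /=; left; rewrite (negbTE adv).
- by case=> -> -> /=; right; rewrite tmp_j.
Qed.

Definition pending t : bool := [exists j, will_advance t j].

Lemma not_pending_TURN t : ~~ pending t -> TURN (st t.+1) = TURN (st t).
Proof.
move=> /existsPn Nadv; case sm: (sched r t) => [m|]; last by rewrite st_idle.
rewrite (bstep_TURN (lo_step sm)); have := Nadv m.
by rewrite /will_advance; case: (ctl (lo t m)) => [||[] []||].
Qed.

Lemma will_advance_start t j : ~~ pending t -> will_advance t.+1 j ->
  TURN (st t.+1) = TURN (st t) /\ FLAG (st t.+1) (TURN (st t)) = false.
Proof.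
move=> Np; have keep := not_pending_TURN Np; move/existsPn: Np => Nadv.
move=> adv; split=> //; move: adv; rewrite /will_advance keep.
have [sj|/eqP/lo_frame E] := eqVneq (sched r t) (Some j); last first.
  by have := Nadv j; rewrite /will_advance E => /negP.
have := @FLAG_raised t.+1 j; have := lo_step sj; have := @tmp_TURN t j.
have {Nadv} := Nadv j; rewrite /will_advance /bstep.
case ctl_j: (ctl (lo t j)) => [||[] []||] /= Nadv tmp_j;
  try by case=> E _ _; rewrite E; move: Nadv => /=; do ?case: ifP; try by [];
    move=> /negbTE->.
- by case=> -> _ /= FLAG_j /eqP<-.
- by case=> -> -> /= _; rewrite tmp_j// => /negbTE.
all: by case: ifP => _; [case=> -> | case=> d [x [_ -> _]]; rewrite /= ctl_j].
Qed.

(* Where a process cannot have passed the test of its gate since TURN took its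
   present value [k], as long as FLAG[k] is raised. *)
Definition before_gate k l : bool :=
  match ctl l with
  | Access W3 Executed | DLFunlock | Idle | Access W1 _
  | Access R1 (Ready | Started) => true
  | Access R1 Executed | Access R2 (Ready | Started) => tmp l == k
  | Access R2 Executed => flag l
  | _ => false
  end.

(* Process [j] will not enter its critical section (again) before TURN
   changes. *)
Definition spent t j : bool :=
  match ctl (lo t j) with
  | InCritical | Access (W2 | R3 | R4) _ => true
  | _ => [&& FLAG (st t) (TURN (st t)), j != TURN (st t)
           & before_gate (TURN (st t)) (lo t j)]
  end.

(** An owner leaves R4 with a raised flag, since otherwise an increment would be pending; from then
    on FLAG[TURN] stays raised and its gate turns it back. *)
Lemma spent_step t j :
  ~~ pending t -> ~~ pending t.+1 -> spent t j -> spent t.+1 j.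
Proof.
move=> Np Np'; have keepT := not_pending_TURN Np.
set k := TURN (st t) in keepT.
(* Only p_k can lower FLAG[k], and its W2 would make an increment pending at [t.+1]. *)
have keepF : FLAG (st t) k -> FLAG (st t.+1) k.
  rewrite !FLAG_raised.
  have [sk|/eqP/lo_frame->//] := eqVneq (sched r t) (Some k).
  move/existsPn: Np' => /(_ k); rewrite /will_advance keepT.
  have := lo_step sk; rewrite /bstep.
  case ctl_k: (ctl (lo t k)) => [||[] []||] //=; try by case=> -> _ //=.
  all: try by case=> -> _ /=; case: ifP.
  - by case=> -> _ /=; rewrite eqxx.
  - by case: ifP => _; [case=> -> | case=> d [x [_ -> _]]; rewrite /= ctl_k].
have [sj|/eqP/lo_frame E] := eqVneq (sched r t) (Some j); last first.
  rewrite /spent E keepT -/k.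
  by case: ctl => [||[] ?||] // /and3P[/keepF-> -> ->].
have FLAG_j := FLAG_raised t j.
have := lo_step sj; have := @tmp_TURN t j; have := @R4_flag t j.
move/existsPn: Np => /(_ j).
rewrite /spent /will_advance /before_gate keepT -/k.
rewrite /bstep; move: FLAG_j.
case ctl_j: (ctl (lo t j)) => [||[] []||] //= FLAG_j Nadv fl tmp_j;
  try by case=> E _ _; rewrite E.
all: try by case=> E _ /and3P[F jk before]; rewrite E /= keepF// jk ?eqxx.
- case=> E _ /and3P[F jk /eqP tk]; rewrite E /= keepF// jk tk eqxx.
  by rewrite eq_sym (negbTE jk).
- by case=> E _ /and3P[F jk /eqP tk]; rewrite E /= keepF// jk tk.
- by case=> E _ /and3P[F jk before]; rewrite E /= before /= keepF// jk.
(* R4 found FLAG[k] raised and it still is, whereas the flag of [j] is down: so [j] is not [k]. *)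
- case=> E _ _; rewrite E; case flag_j: (flag _) Nadv => //= _.
  have Fk : FLAG (st t) k by apply: fl.
  by rewrite keepF// andbT; apply/eqP => jk; rewrite jk Fk in FLAG_j.
- by move=> _ /and3P[].
- case: ifP => _; first by case=> E _ /and3P[F jk _]; rewrite E /= keepF// jk.
  by case=> d [x [_ E _]] /and3P[F jk _]; rewrite E /= ctl_j keepF// jk.
Qed.

Lemma enters_not_pending t j : enters_critical r t j ->
  ~~ pending t /\ ~~ pending t.+1.
Proof.
move=> /enters_criticalP[ctl_j C ctl_j'].
split; apply/existsPn => m; apply/negP => adv.
  have mj : m = j.
    exact: dlf_critical_inj (in_critical_dlf (will_advance_in_critical adv)) C.
  by move: adv; rewrite mj /will_advance ctl_j.
have mj : m = j.
  by apply: in_critical_inj (will_advance_in_critical adv) _; rewrite ctl_j'.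
by move: adv; rewrite mj /will_advance ctl_j'.
Qed.

(** * The potential and the bound on the losses *)

Section Waiting.
Variable i : 'I_n.
Hypothesis n_gt1 : 1 < n.

Definition unspent t : {set 'I_n} := [set j | (j != i) && ~~ spent t j].

(** The cyclic distance from [k] to [i]; adding [n] keeps the subtraction from truncating. *)
Definition turns_to k : nat := (i + n - k) %% n.

(* A bound on the losses of [i] still to come: n - 1 per phase, minus the entry
   which the process setting TURN to [i] cannot make.  During a pending increment
   nobody enters, and TURN may still be [i] from before W1, in which case the
   successor of TURN is n - 1 increments away. *)
Definition potential t : nat :=
  if pending t then (turns_to (ordS (TURN (st t)))).+1 * n.-1 - 1
  else turns_to (TURN (st t)) * n.-1 - (0 < turns_to (TURN (st t)))
       + #|unspent t|.

Lemma turns_to_lt k : turns_to k < n.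
Proof. by rewrite ltn_mod; apply: leq_ltn_trans (ltn_ord i). Qed.

Lemma turns_to_eq0 k : (turns_to k == 0) = (k == i).
Proof.
rewrite -val_eqE /=; have := ltn_ord i; have := ltn_ord k; rewrite /turns_to.
case: (leqP k i) => ki kn lt_in.
  by rewrite (_ : i + n - k = (i - k) + n) ?modnDr ?modn_small; lia.
by rewrite modn_small; lia.
Qed.

Lemma turns_to_ordS k : k != i -> turns_to k = (turns_to (ordS k)).+1.
Proof.
rewrite -val_eqE /=; have := ltn_ord i; have := ltn_ord k; rewrite /turns_to /=.
have [kn1|kn1] := eqVneq k.+1 n.
  rewrite kn1 modnn subn0 modnDr => kn lt_in ki.
  by rewrite (modn_small lt_in) modn_small; lia.
move=> kn lt_in ki; rewrite (@modn_small k.+1); last lia.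
case: (ltngtP k i) ki => // ki _; last by rewrite !modn_small; lia.
rewrite (_ : i + n - k = (i - k) + n); last lia.
rewrite (_ : i + n - k.+1 = (i - k.+1) + n); last lia.
by rewrite !modnDr !modn_small; lia.
Qed.

Lemma unspent_le t : #|unspent t| <= n.-1.
Proof.
rewrite -[n in leqRHS]card_ord -(cardsC1 i); apply/subset_leq_card/subsetP => j.
by rewrite !inE => /andP[].
Qed.

(** The distance is below [n]. At distance 0 no loss is subtracted, but [n.-1 <= n * n.-1 - 1] holds
    because [1 < n]. *)
Lemma potential_le t : potential t <= n * n.-1 - 1.
Proof.
rewrite /potential; case: ifP => _.
  by rewrite leq_sub2r// leq_mul2r turns_to_lt orbT.
have := unspent_le t; case: posnP => [->|gt0]; first by nia.
have := turns_to_lt (TURN (st t)); nia.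
Qed.

Definition waiting t : bool :=
  match ctl (lo t i) with
  | Access W1 Executed | Access (R1 | R2) _ | DLFlock => true
  | _ => false
  end.

Lemma waiting_FLAG t : waiting t -> FLAG (st t) i.
Proof. by rewrite FLAG_raised /waiting; case: ctl => [||[] []||]. Qed.

Lemma sum_enters t :
  (exists j, [/\ j != i, enters_critical r t j &
    \sum_(j < n | j != i) enters_critical r t j = 1]) \/
  \sum_(j < n | j != i) enters_critical r t j = 0.
Proof.
have [/existsP[j /andP[ji ent]]|/existsPn none] :=
    boolP [exists j, (j != i) && enters_critical r t j].
  left; exists j; split=> //; rewrite (bigD1 j)//= ent big1 // => m /andP[_ mj].
  apply/eqP; rewrite eqb0; apply: contra mj => ent'; apply/eqP.
  have [_ _ Cm] := enters_criticalP ent'; have [_ _ Cj] := enters_criticalP ent.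
  by apply: (@in_critical_inj t.+1); rewrite ?Cm ?Cj.
right; rewrite big1 // => j ji; apply/eqP; rewrite eqb0.
by have := none j; rewrite ji.
Qed.

(** Entries occur only at steps with no increment pending before or after; each of them removes a
    process from [unspent]. *)
Lemma potential_step t : waiting t -> waiting t.+1 ->
  potential t.+1 + \sum_(j < n | j != i) enters_critical r t j <= potential t.
Proof.
move=> /waiting_FLAG Fi /waiting_FLAG Fi'.
case: (boolP (pending t)) => [/existsP[j adv]|Np].
  have -> : \sum_(j < n | j != i) enters_critical r t j = 0.
    have [[m [_ /enters_not_pending[/existsPn/(_ j)]]]|//] := sum_enters t.
    by rewrite adv.
  rewrite addn0 {2}/potential (_ : pending t); last by apply/existsP; exists j.
  have [[adv' keepT]|[ctl_j incT]] := will_advance_step adv.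
    by rewrite /potential keepT (_ : pending _)//; apply/existsP; exists j.
  have Np' : ~~ pending t.+1.
    apply/existsPn => m; apply/negP => adv'.
    have mj : m = j.
      apply: in_critical_inj (will_advance_in_critical adv') _.
      by rewrite ctl_j.
    by move: adv'; rewrite mj /will_advance ctl_j.
  rewrite /potential (negbTE Np') incT; set k := ordS _ in incT *.
  have le_u := unspent_le t.+1.
  case: posnP => [k0|gt0]; last by nia.
  (* TURN has just reached [i]. Its writer [j] is not [i], whose flag is raised, and [j] is spent at
     once: this is the loss subtracted in advance. *)
  rewrite k0; have ki : k = i by apply/eqP; rewrite -turns_to_eq0 k0.
  have ji : j != i.
    apply/eqP => ji; move: Fi; rewrite FLAG_raised -ji.
    by move: adv; rewrite /will_advance; case: ctl => [||[] []||].
  have : unspent t.+1 \subset [set~ i] :\ j.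
    apply/subsetP => m; rewrite !inE => /andP[mi spent_m]; rewrite mi andbT.
    apply: contra spent_m => /eqP->.
    by rewrite /spent ctl_j incT ki Fi' ji /before_gate ctl_j.
  move/subset_leq_card; have := cardsD1 j [set~ i].
  by rewrite cardsC1 card_ord !inE ji mul0n mul1n => ->; rewrite add1n subn1.
case: (boolP (pending t.+1)) => [/existsP[j adv]|Np'].
  have -> : \sum_(j < n | j != i) enters_critical r t j = 0.
    have [[m [_ /enters_not_pending[_ /existsPn/(_ j)]]]|//] := sum_enters t.
    by rewrite adv.
  have [keepT FT] := will_advance_start Np adv.
  rewrite /potential (negbTE Np) (_ : pending t.+1); last first.
    by apply/existsP; exists j.
  (* FLAG[TURN] is down while FLAG[i] is raised, so the increment will bring TURN one closer to
     [i]. *)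
  have Ti : TURN (st t) != i by apply/eqP => Ti; rewrite Ti Fi' in FT.
  by rewrite keepT (turns_to_ordS Ti) addn0 leq_addr.
rewrite /potential (negbTE Np) (negbTE Np') not_pending_TURN// -addnA leq_add2l.
have sub : unspent t.+1 \subset unspent t.
  apply/subsetP => j; rewrite !inE => /andP[-> /=].
  by apply: contra; apply: spent_step.
have [[j [ji ent ->]]|->] := sum_enters t; last first.
  by rewrite addn0 subset_leq_card.
rewrite addn1; apply: proper_card; rewrite properE sub /=.
have [ctl_j _ ctl_j'] := enters_criticalP ent.
(* At [DLFlock] the entering process is past its gate, hence unspent; at [InCritical] it is
   spent. *)
apply/subsetPn; exists j; rewrite !inE ji /spent ?ctl_j ?ctl_j' //=.
by rewrite /before_gate ctl_j !andbF.
Qed.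

Lemma potential_sum t u :
  t <= u -> (forall v, t <= v <= u -> waiting v) ->
  potential u + \sum_(t <= d < u) \sum_(j < n | j != i) enters_critical r d j
    <= potential t.
Proof.
move=> /subnK <-; elim: (u - t) => [|v IH] wait.
  by rewrite big_geq ?addn0.
rewrite addSn big_nat_recr ?leq_addl//= addnCA addnC.
apply: leq_trans (IH _); last by move=> w ?; apply: wait; lia.
by rewrite leq_add2r; apply: potential_step; apply: wait; lia.
Qed.

Lemma waiting_step t : waiting t -> waiting t.+1 \/ enters_critical r t i.
Proof.
rewrite /enters_critical /region_at /= -!/(lo _ _) /bregion /waiting => wait.
have [si|/eqP/lo_frame->] := eqVneq (sched r t) (Some i); last by left.
have := lo_step si; move: wait; rewrite /bstep.
case ctl_i: (ctl (lo t i)) => [||[] []||] //= _;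
  try by case=> -> _ /=; left; do ?case: ifP.
case: ifP => _; first by case=> -> _; right.
by case=> d [x [_ -> _]]; left; rewrite /= ctl_i.
Qed.

(** Induction on the potential: while [i] waits somebody enters, and an entry of another process
    lowers the potential. *)
Lemma waiting_enters t : waiting t ->
  exists b, [/\ t <= b, forall u, t <= u <= b -> waiting u &
    enters_critical r b i].
Proof.
have [N] := ubnP (potential t).
elim: N t => // N IH t; rewrite ltnS => leN wait.
have [u tu [j ent]] : exists2 u, t <= u & exists j, enters_critical r u j.
  apply: (@eventually_enters t i); move: wait.
  rewrite /waiting /region_at /= -/(lo t i) /bregion.
  by case: ctl => [||[] []||].
have prefix v : t <= v -> (forall w, t <= w <= v -> waiting w) \/
    exists b, [/\ t <= b, forall w, t <= w <= b -> waiting w &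
      enters_critical r b i].
  move=> /subnK <-; elim: (v - t) => [|w [ww|ex]]; last by right.
    by left=> w ?; rewrite (_ : w = t)//; lia.
  have wait_wt : waiting (w + t) by apply: ww; rewrite leq_addl leqnn.
  have [ww'|ent'] := waiting_step wait_wt.
    left=> x /andP[tx]; rewrite addSn leq_eqVlt ltnS => /predU1P[->//|xw].
    by apply: ww; rewrite tx.
  by right; exists (w + t); rewrite leq_addl.
have [wait_u|//] := prefix u.+1 (leqW tu).
have wait_le w : t <= w <= u -> waiting w by move=> ?; apply: wait_u; lia.
have [ji|ji] := eqVneq j i; first by exists u; rewrite -ji.
have [||b [ub wait_b ent_b]] := IH u.+1; last first.
- exists b; split=> // [|w /andP[tw wb]]; first by lia.
  by case: (leqP w u.+1) => ?; [apply: wait_u | apply: wait_b]; lia.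
- by apply: wait_u; lia.
have := potential_sum tu wait_le.
have := potential_step (wait_u u _) (wait_u u.+1 _).
rewrite (bigD1 j)//= ent; lia.
Qed.

End Waiting.

(** * The lock of p_i and the final count *)

Lemma enters_is_lock t b i : 1 < n -> waiting i t ->
  t <= b -> (forall u, t <= u <= b -> waiting i u) -> enters_critical r b i ->
  exists a, [/\ a < t, is_lock r i a b &
    \sum_(t <= d < b) \sum_(j < n | j != i) enters_critical r d j
      <= n * n.-1 - 1].
Proof.
move=> n_gt1 wait tb wait_tb ent.
have locking u : waiting i u -> region_at r u i = Locking.
  by rewrite /waiting /region_at /= -/(lo u i) /bregion; case: ctl => [||[]||].
have [a [lt_at Ra La]] := lock_start (locking _ wait).
exists a; split=> //.
  apply/is_lockP; split=> // [|u /andP[au ub]|].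
  - exact: leq_trans lt_at tb.
  - case: (leqP u t) => ut; first by apply: La; rewrite au.
    by apply/locking/wait_tb; rewrite ltnW.
  - by case/andP: ent => _ /eqP.
apply: leq_trans (potential_le i n_gt1 t).
by apply: leq_trans (potential_sum n_gt1 tb wait_tb); apply: leq_addl.
Qed.

End AlgorithmB.

Theorem theorem4p6 (n : nat) (n_gt1 : 1 < n) (DLF : protocol n)
    (DLF_mutex : mutual_exclusion DLF) (DLF_dlf : deadlock_free DLF)
    (r : execution (algorithmB DLF)) (i : 'I_n) (t : nat)
    (W1_done : completes r t i W1) :
  exists a b : nat,
    [/\ a < t < b, is_lock r i a b & losses r i a b t <= n * (n - 1) - 1].
Proof.
case: W1_done => si ctl_i.
(* The potential is taken at [t.+1], as only losses after step [t] count. *)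
have wait : waiting r i t.+1.
  by have := lo_step si; rewrite /waiting /bstep /lo ctl_i => -[-> _].
have [b [tb wait_tb ent]] := waiting_enters DLF_mutex DLF_dlf n_gt1 wait.
have [a [lt_at lock_i bound]] :=
  enters_is_lock DLF_mutex n_gt1 wait tb wait_tb ent.
(* So far only [a < t.+1] is known; at [t] process [i] is still in W1, hence already locking. *)
have a_neq_t : a <> t.
  move=> at_eq; have [_ + _ _] := is_lockP _ _ _ _ lock_i.
  by rewrite at_eq /region_at /= /bregion ctl_i.
exists a, b; rewrite tb andbT; split=> //; first by lia.
by rewrite [n - 1]subn1; apply: leq_trans (losses_le_enters _ _ _ _ _) bound.
Qed.
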